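(* Let $1\le k\le n$ and let $\alpha_{i,m}$, $k\le i\le m$, $k\le m\le n$, be given critical values (with $m$ standing for $|I|$) such that $\alpha_{i,m}$ is increasing in $i$ and decreasing in $m$ (both in the weak sense). Then: (i) The closed testing procedure with critical values $\alpha_{i,|I|}$ is equivalent to the generalized Hommel procedure with the same critical values. (ii) If for each $I\subset\{1,\dots,n\}$ with $|I|\ge k$ the local test $(I:\alpha_{i,|I|},\,k\le i\le|I|)$ is a level $\alpha$ test of $H_I$, then the generalized Hommel procedure with critical values $\alpha_{i,|I|}$ controls the $k$-FWER at level $\alpha$.
   Context: Setting: $H_1,\dots,H_n$ are null hypotheses (subsets of $\Omega$, the set of all possible distributions of the data), with $p$-values $P_1,\dots,P_n$ such that $P\{P_i\le u\}\le u$ for all $u\in(0,1)$ whenever $H_i$ is true (joint dependence arbitrary). The family satisfies the free combination condition: for any $I\subseteq\{1,\dots,n\}$ there is $P\in\Omega$ for which all $H_i$, $i\in I$, are true and all $H_i$, $i\notin I$, are false. The ordered $p$-values are $P_{(1)}\le\cdots\le P_{(n)}$ with associated hypotheses $H_{(1)},\dots,H_{(n)}$; the same ordering is used by all procedures. For $I\subset\{1,\dots,n\}$ with $|I|\ge k$, $H_I=\bigcap_{i\in I}H_i$ and $P_{1:I}\le\cdots\le P_{|I|:I}$ are the ordered values of $P_i$, $i\in I$. Local test: $(I:\alpha_{i,|I|},\,k\le i\le|I|)$ rejects $H_I$ iff $P_{j:I}\le\alpha_{j,|I|}$ for at least one $j\in\{k,\dots,|I|\}$. It is level $\alpha$ if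 $P\big(\bigcup_{j=k}^{|I|}\{P_{j:I}\le\alpha_{j,|I|}\}\big)\le\alpha$ whenever $H_I$ is true. Closed testing procedure with critical values $\alpha_{i,|I|}$: it automatically rejects $H_{(1)},\dots,H_{(k-1)}$, and it rejects any other $H_i$ iff $H_I$ is rejected by the local test $(I:\alpha_{j,|I|},\,k\le j\le|I|)$ for all $I\subset\{1,\dots,n\}$ with $|I|\ge k$, $i\in I$ and $P_i\ge P_{k:I}$. Generalized Hommel procedure with critical values $\alpha_{i,m}$: compute $j=\max\{i\in\{k,\dots,n\}: P_{(n-i+l)}>\alpha_{l,i}\text{ for all } l=k,\dots,i\}$. If the maximum does not exist (the set is empty), reject all $H_{(i)}$, $i=k,\dots,n$; otherwise reject all $H_{(i)}$, $i=k,\dots,n$, with $P_{(i)}\le\alpha_{k,j}$. In any case $H_{(1)},\dots,H_{(k-1)}$ are automatically rejected. Two procedures are equivalent if they always reject (and accept) the same individual hypotheses. $k$-FWER: if $V$ is the number of true null hypotheses that are rejected, $k\text{-FWER}=P\{V\ge k\}$; a procedure controls it at level $\alpha$ if $P\{V\ge k\}\le\alpha$ for every $P\in\Omega$. *)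

(* Defs.v *)
From HB Require Import structures.
From mathcomp Require Import all_boot all_order all_algebra all_fingroup.
From mathcomp Require Import all_classical all_reals all_analysis.

Set Implicit Arguments.
Unset Strict Implicit.
Unset Printing Implicit Defensive.

Import Order.TTheory GRing.Theory Num.Theory.
Local Open Scope ring_scope.

Section Procedures.
Context {R : realType} {n : nat}.
Implicit Types (p : 'I_n -> R) (s : {perm 'I_n}) (I : {set 'I_n})
  (k : nat) (crit : nat -> nat -> R).

(* P_{j:I}, with j counted from 1; the default 0 is returned only for
   j > #|I|. *)
Definition ordered_pvalue p I (j : nat) : R :=
  nth 0 (sort <=%R [seq p i | i <- enum I]) j.-1.

(* s lists the hypotheses by nondecreasing p-value, with an arbitrary choice
   among ties: the hypothesis H_(r) is the one of index s (r - 1). *)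
Definition is_ordering p s : Prop :=
  forall a b : 'I_n, (a <= b)%N -> p (s a) <= p (s b).

(* The r in 1..n such that H_i is H_(r). *)
Definition rank s (i : 'I_n) : nat := (s^-1%g i).+1.

Definition local_rejects k crit p I : bool :=
  [exists j : 'I_n.+1,
    (k <= j <= #|I|)%N && (ordered_pvalue p I j <= crit j #|I|)].

(* A procedure maps the p-values and their ordering to the set of (indices of)
   rejected hypotheses. *)
Definition procedure := ('I_n -> R) -> {perm 'I_n} -> {set 'I_n}.

Definition equivalent (phi psi : procedure) : Prop :=
  forall p s, is_ordering p s -> phi p s = psi p s.

Definition closed_testing k crit : procedure := fun p s =>
  [set i : 'I_n | (rank s i < k)%N ||
    [forall I : {set 'I_n},
      [&& (k <= #|I|)%N, i \in I & ordered_pvalue p I k <= p i] ==>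
        local_rejects k crit p I]].

Definition hommel_set k crit p : {set 'I_n.+1} :=
  [set i : 'I_n.+1 | (k <= i)%N &&
    [forall l : 'I_n.+1, (k <= l <= i)%N ==>
      (crit l i < ordered_pvalue p [set: 'I_n] (n - i + l))]].

Definition hommel k crit : procedure := fun p s =>
  let J := hommel_set k crit p in
  if J == finset.set0 then [set: 'I_n] else
  [set i : 'I_n | (rank s i < k)%N ||
    (p i <= crit k (\max_(j in J) (j : nat))%N)].

End Procedures.

Arguments procedure : clear implicits.

Section Model.
Context {R : realType} {d : measure_display} {X : measurableType d} {n : nat}.
Implicit Types (Omega : set (probability X R))
  (H : 'I_n -> set (probability X R)) (P : 'I_n -> {mfun X >-> R})
  (ord : X -> {perm 'I_n}) (Q : probability X R).
Local Open Scope classical_set_scope.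

Definition free_combination Omega H : Prop :=
  forall I : {set 'I_n}, exists2 Q, Omega Q & forall i, H i Q <-> i \in I.

Definition valid_pvalues H P : Prop :=
  forall i Q, H i Q -> forall u : R, 0 < u < 1 ->
    (Q [set x | (P i x <= u)%R] <= u%:E)%E.

Definition pvalues P (x : X) : 'I_n -> R := fun i => P i x.

(* Measurability of the tie-breaking makes the event {V >= k} measurable. *)
Definition measurable_ordering P ord : Prop :=
  (forall x, is_ordering (pvalues P x) (ord x)) /\
  (forall s, measurable [set x | ord x = s]).

Definition intersection_hypothesis H (I : {set 'I_n}) :
    set (probability X R) :=
  \bigcap_(i in [set` I]) H i.

Definition level_local_test H P (k : nat) (crit : nat -> nat -> R)
    (I : {set 'I_n}) (alpha : R) : Prop :=
  forall Q, intersection_hypothesis H I Q ->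
    (Q [set x | local_rejects k crit (pvalues P x) I] <= alpha%:E)%E.

Definition true_nulls H Q : {set 'I_n} := finset (fun i => `[< H i Q >]).

Definition false_rejections H P ord (phi : procedure R n) Q (x : X) : nat :=
  #|(true_nulls H Q :&: phi (pvalues P x) (ord x))%SET|.

Definition kFWER H P ord (phi : procedure R n) (k : nat) Q : \bar R :=
  Q [set x | (k <= false_rejections H P ord phi Q x)%N].

Definition controls_kFWER Omega H P ord (phi : procedure R n) (k : nat)
    (alpha : R) : Prop :=
  forall Q, Omega Q -> (kFWER H P ord phi k Q <= alpha%:E)%E.

End Model.

(* Main.v *)
Require Import Defs.
From HB Require Import structures.
From mathcomp Require Import all_boot all_order all_algebra all_fingroup.
From mathcomp Require Import all_classical all_reals all_analysis.
From mathcomp Require Import measurable_realfun zify.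

Set Implicit Arguments.
Unset Strict Implicit.
Unset Printing Implicit Defensive.

Import Order.TTheory GRing.Theory Num.Theory.
Local Open Scope ring_scope.

(** Everything is expressed by counting: the j-th smallest p-value of I is at
    most c exactly when at least j of the p-values of I are at most c.

    The two procedures agree because the Hommel index set singles out the least
    favourable intersection hypotheses. Suppose that H_i, of rank at least k,
    is kept by the closed testing procedure, because of an accepted set I of
    size m with P_{k:I} <= P_i. At most n - m of the hypotheses lie outside I,
    so the m largest p-values dominate those of I order by order; hence m is an
    admissible Hommel index ([accepted_in_hommel_set]) and the maximal index j
    exists. As m <= j and the critical values decrease with the size,
    P_i >= P_{k:I} > crit k m >= crit k j, so Hommel keeps H_i. Conversely, if
    P_i > crit k j, some set of size j that contains i, which consists of k - 1
    hypotheses of least rank, one of intermediate rank and the j - k of largest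
    rank, is accepted ([hommel_critical_set]).

    The error bound is proved for the closed testing procedure and transferred.
    Let T be the set of true null hypotheses. If at least k members of T are
    rejected, the rejected member of T of largest rank has rank at least k and
    its p-value is at least P_{k:T}, so its rejection was decided by the local
    tests, that of T among them ([closed_testing_local_rejects]). Thus the
    event V >= k is contained in the event that the local test rejects the true
    hypothesis H_T, which has probability at most alpha. When T has fewer than
    k members the event is empty, and it remains to see that alpha is
    nonnegative: by free combination some distribution makes all hypotheses
    true, and for it alpha bounds a probability.

    Monotonicity of a probability needs both events to be measurable. They are
    Boolean combinations of finitely many comparisons of p-values with each
    other or with constants, and of events that fix the ordering. *)

(** * Order statistics and counting *)

Definition card_below (R : realType) (n : nat) (p : 'I_n -> R)
    (I : {set 'I_n}) (c : R) : nat :=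
  #|[set i in I | p i <= c]|.

(** Trades sorted sequences for cardinals, which behave well under inclusion
    and measurability. The range of j keeps clear of the default value of
    [ordered_pvalue]. *)
Lemma ordered_pvalue_le (R : realType) (n : nat) (p : 'I_n -> R)
    (I : {set 'I_n}) (j : nat) (c : R) : (0 < j <= #|I|)%N ->
  (ordered_pvalue p I j <= c) = (j <= card_below p I c)%N.
Proof.
case: j => [//|j] /andP[_ jI]; rewrite /ordered_pvalue /=.
set t := sort _ _.
have t_sorted : sorted <=%R t by exact: sort_le_sorted.
have -> : card_below p I c = count (<= c) t.
  rewrite (seq.permP (permEl (perm_sort _ _))) count_map /card_below cardE.
  rewrite /enum_mem size_filter count_filter.
  by apply: eq_count => i; rewrite /= !inE andbC.
have t_size : size t = #|I| by rewrite /t size_sort size_map cardE.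
apply/idP/idP => [|lt_j]; last exact: nth_count_le.
apply: contraTT; rewrite -ltnNge -ltNge ltnS => le_j.
by apply: nth_count_gt; rewrite // le_j t_size.
Qed.

Lemma local_rejectsPn (R : realType) (n k : nat) (crit : nat -> nat -> R)
    (p : 'I_n -> R) (I : {set 'I_n}) : (0 < k)%N ->
  reflect (forall l, (k <= l <= #|I|)%N ->
             (card_below p I (crit l #|I|) < l)%N)
          (~~ local_rejects k crit p I).
Proof.
move=> k_gt0; rewrite /local_rejects negb_exists.
apply: (iffP forallP) => [accI l /andP[kl lI]|accI l].
  have ln : (l < n.+1)%N.
    by rewrite ltnS (leq_trans lI) // (leq_trans (max_card _)) ?card_ord.
  have := accI (Ordinal ln); rewrite /= kl lI /= ordered_pvalue_le ?lI ?andbT.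
    by rewrite -ltnNge.
  exact: leq_trans kl.
apply/nandP; case: (boolP (k <= l <= #|I|)%N) => [klI|]; [right|by left].
rewrite ordered_pvalue_le -?ltnNge; first exact: accI.
by case/andP: klI => kl ->; rewrite (leq_trans k_gt0).
Qed.

Lemma hommel_setP (R : realType) (n k : nat) (crit : nat -> nat -> R)
    (p : 'I_n -> R) (j : 'I_n.+1) : (0 < k)%N ->
  reflect ((k <= j)%N /\ forall l, (k <= l <= j)%N ->
             (card_below p [set: 'I_n] (crit l j) < n - j + l)%N)
          (j \in hommel_set k crit p).
Proof.
move=> k_gt0; have jn : (j <= n)%N by rewrite -ltnS.
have thr l : (k <= l <= j)%N ->
    (crit l j < ordered_pvalue p [set: 'I_n] (n - j + l)) =
    (card_below p [set: 'I_n] (crit l j) < n - j + l)%N.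
  move=> klj; rewrite ltNge ordered_pvalue_le ?ltnNge //.
  by rewrite cardsT card_ord; lia.
rewrite inE; apply: (iffP andP) => -[kj accj]; split=> //.
  move=> l klj; have ln : (l < n.+1)%N by lia.
  by rewrite -thr //; move/forallP/(_ (Ordinal ln))/implyP/(_ klj): accj.
by apply/forallP => l; apply/implyP => klj; rewrite thr //; exact: accj.
Qed.

(** * Accepted sets and Hommel indices *)

(** The #|I| largest p-values dominate those of I: passing from I to all
    hypotheses adds at most n - #|I| p-values below any threshold. *)
Lemma accepted_in_hommel_set (R : realType) (n k : nat)
    (crit : nat -> nat -> R) (p : 'I_n -> R) (I : {set 'I_n}) :
  (0 < k <= #|I|)%N -> ~~ local_rejects k crit p I ->
  exists2 j : 'I_n.+1, j \in hommel_set k crit p & j = #|I| :> nat.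
Proof.
case/andP=> k_gt0 kI accI; have {}accI := local_rejectsPn crit p I k_gt0 accI.
have In : (#|I| < n.+1)%N by rewrite ltnS (leq_trans (max_card _)) ?card_ord.
exists (Ordinal In) => //; apply/hommel_setP => //=; split=> // l klI.
set c := crit _ _; have := accI _ klI; rewrite -/c => below_lt.
have : (card_below p [set: 'I_n] c <= card_below p I c + #|~: I|)%N.
  apply: leq_trans (leq_card_setU _ _).1.
  apply: subset_leq_card.
  apply/fintype.subsetP => i; rewrite !inE.
  by case: (i \in I); rewrite ?orbF ?orbT.
rewrite cardsCs finset.setCK card_ord => /leq_ltn_trans; apply.
by rewrite addnC ltn_add2l.
Qed.

(** * Ranks *)

Lemma rank_bounds (n : nat) (s : {perm 'I_n}) (i : 'I_n) :
  (0 < rank s i <= n)%N.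
Proof. by rewrite /rank ltn_ord. Qed.

Lemma rank_inj (n : nat) (s : {perm 'I_n}) : injective (rank s).
Proof. by move=> i j [] /val_inj /perm_inj. Qed.

Lemma rank_surj (n : nat) (s : {perm 'I_n}) (r : nat) :
  (0 < r <= n)%N -> exists i, rank s i = r.
Proof.
case: r => [//|r] /andP[_ rn].
by exists (s (Ordinal rn)); rewrite /rank permK.
Qed.

Lemma ordering_rank (R : realType) (n : nat) (p : 'I_n -> R)
    (s : {perm 'I_n}) (i j : 'I_n) : is_ordering p s ->
  (rank s i <= rank s j)%N -> p i <= p j.
Proof.
by move=> ps; rewrite /rank ltnS => /ps; rewrite !permKV.
Qed.

Definition ranks_between (n : nat) (s : {perm 'I_n}) (lo hi : nat) :
  {set 'I_n} := [set i | (lo < rank s i <= hi)%N].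

Lemma card_ranks_between (n : nat) (s : {perm 'I_n}) (lo hi : nat) :
  (hi <= n)%N -> #|ranks_between s lo hi| = (hi - lo)%N.
Proof.
move=> hin.
have -> : ranks_between s lo hi =
    [set s b | b in [set b : 'I_n | (lo <= b < hi)%N]].
  apply/setP => i; rewrite inE; apply/idP/imsetP => [lohi|[b]].
    by exists ((s^-1)%g i); rewrite ?inE ?permKV.
  by rewrite inE => lohi ->; rewrite /rank permK.
rewrite card_imset; last exact: perm_inj.
rewrite -sum1dep_card -(big_mkord (fun b => (lo <= b < hi)%N) (fun=> 1%N)).
rewrite (eq_bigl (fun b => (lo <= b)%N && (b < hi)%N)) //.
rewrite -(big_nat_widen 0 hi n (fun b => (lo <= b)%N)) //.
rewrite -(big_nat_widenl lo 0 hi xpredT) //.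
by rewrite sum_nat_const_nat muln1.
Qed.

(** * Equivalence of the two procedures *)

(** The set must have P_{k:I} <= p i and otherwise p-values as large as
    possible. It gets the k - 1 hypotheses of least rank, then at place k the
    hypothesis t of rank min(rank i, n - j + k), and the j - k hypotheses of
    largest rank. For l > k its l-th p-value is P_(n-j+l), which exceeds
    [crit l j] since j is a Hommel index; its k-th one is either p i or
    P_(n-j+k), and both exceed [crit k j]. Capping the rank of t at n - j + k
    keeps t out of the top block, so that the size is exactly j; when the cap
    applies, i itself lies in the top block or equals t. *)
Lemma hommel_critical_set (R : realType) (n k : nat)
    (crit : nat -> nat -> R) (p : 'I_n -> R) (s : {perm 'I_n})
    (j : 'I_n.+1) (i : 'I_n) :
  (0 < k)%N -> is_ordering p s -> j \in hommel_set k crit p ->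
  (k <= rank s i)%N -> crit k j < p i ->
  exists I : {set 'I_n},
    [/\ #|I| = j, i \in I, ordered_pvalue p I k <= p i
      & ~~ local_rejects k crit p I].
Proof.
move=> k_gt0 ps /(hommel_setP crit p j k_gt0)[kj accj] ki lt_pi.
have jn : (j <= n)%N by rewrite -ltnS.
have /andP[_ in_] := rank_bounds s i.
(* Otherwise all ranks up to that of i' would count as below the threshold. *)
have pgt l i' : (k <= l <= j)%N -> (n - j + l <= rank s i')%N ->
    crit l j < p i'.
  move=> klj le_i'; rewrite ltNge; apply: contraTN (accj l klj) => le_pi'.
  have /andP[_ i'n] := rank_bounds s i'.
  rewrite -leqNgt (leq_trans le_i') // -[leqLHS]subn0.
  rewrite -(card_ranks_between s 0 i'n) subset_leq_card //.
  apply/fintype.subsetP => a; rewrite !inE /= => le_a.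
  by rewrite (le_trans _ le_pi') // (ordering_rank ps).
pose r := minn (rank s i) (n - j + k).
have [t tr] : exists t, rank s t = r by apply: rank_surj; rewrite /r; lia.
have le_pt : p t <= p i by apply: (ordering_rank ps); rewrite tr geq_minl.
have gt_pt : crit k j < p t.
  have [le_ik|lt_ki] := leqP (rank s i) (n - j + k).
    suff -> : t = i by [].
    by apply: (@rank_inj _ s); rewrite tr /r (minn_idPl le_ik).
  by apply: pgt; rewrite ?leqnn //= tr /r; lia.
pose I := t |: (ranks_between s 0 k.-1 :|: ranks_between s (n - j + k) n).
have cardI : #|I| = j.
  rewrite /I cardsU1 !inE tr /r cardsU !card_ranks_between; try lia.
  rewrite (_ : _ :&: _ = finset.set0) ?cards0; first lia.
  by apply/setP => a; rewrite !inE; lia.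
exists I; split=> //.
- rewrite !inE; have [le_ik|lt_ki] := leqP (rank s i) (n - j + k).
    by rewrite -(inj_eq (@rank_inj _ s)) tr /r (minn_idPl le_ik) eqxx.
  by rewrite in_ !orbT.
- rewrite ordered_pvalue_le; last by rewrite cardI k_gt0.
  have -> : k = #|t |: ranks_between s 0 k.-1|.
    by rewrite cardsU1 !inE tr /r card_ranks_between; lia.
  apply: subset_leq_card; apply/fintype.subsetP => a.
  rewrite !inE /=; case/orP => [/eqP->|le_a]; first by rewrite eqxx le_pt.
  by rewrite le_a orbT (ordering_rank ps) //; lia.
(* Members of I at or below [crit l j] have rank less than n - j + l, and for
   l = k also t is excluded; at most l - 1 members of I are left. *)
apply/local_rejectsPn => // l; rewrite cardI => /andP[kl lj].
move: kl; rewrite leq_eqVlt => /predU1P[<-|lt_kl].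
  apply: leq_ltn_trans (_ : #|ranks_between s 0 k.-1| < k)%N.
    apply: subset_leq_card; apply/fintype.subsetP => a; rewrite !inE /=.
    case/andP=> /or3P[/eqP->|//|lt_a]; rewrite leNgt ?gt_pt //.
    by rewrite pgt // ?leqnn //; lia.
  by rewrite card_ranks_between; lia.
apply: (@leq_ltn_trans
  #|t |: (ranks_between s 0 k.-1 :|:
          ranks_between s (n - j + k) (n - j + l).-1)|).
  apply: subset_leq_card; apply/fintype.subsetP => a; rewrite !inE.
  case/andP=> /or3P[->//|->|lt_a]; rewrite ?orbT // leNgt => le_pa.
  apply/orP; right; apply/orP; right.
  case: (leqP (n - j + l) (rank s a)) => [le_a|]; last by lia.
  by rewrite pgt // in le_pa; lia.
rewrite cardsU1 (leq_ltn_trans (leq_add (leq_b1 _) (leq_card_setU _ _).1)) //.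
by rewrite !card_ranks_between; lia.
Qed.

Lemma closed_testing_eq_hommel (R : realType) (n k : nat)
    (crit : nat -> nat -> R) :
  (0 < k)%N ->
  (forall m m' : nat, (k <= m)%N -> (m <= m')%N -> (m' <= n)%N ->
     crit k m' <= crit k m) ->
  equivalent (closed_testing k crit : procedure R n) (hommel k crit).
Proof.
move=> k_gt0 crit_decr p s ps; apply/setP => i; rewrite /hommel inE.
have [lt_ik|ki] /= := ltnP (rank s i) k.
  by case: ifP => _; rewrite inE ?lt_ik.
have inHommel (I : {set 'I_n}) := @accepted_in_hommel_set R n k crit p I.
have [J0|/set0Pn[j0 j0J]] := eqVneq (hommel_set k crit p) finset.set0.
  rewrite inE; apply/forallP => I; apply/implyP => /and3P[kI _ _].
  apply: contraT => accI; have [|j] := inHommel I _ accI.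
    by rewrite k_gt0.
  by rewrite J0 inE.
rewrite inE ltnNge ki /=.
have [|j jJ maxJ] := @eq_bigmax_cond _ (mem (hommel_set k crit p))
  (fun j : 'I_n.+1 => j : nat); first by apply/card_gt0P; exists j0.
apply/forallP/idP => [rejI|le_pi I].
  rewrite leNgt maxJ; apply/negP => lt_pi.
  have [I [cardI iI le_I accI]] := hommel_critical_set k_gt0 ps jJ ki lt_pi.
  have /hommel_setP[//|kj _] := jJ.
  by have := rejI I; rewrite cardI kj iI le_I (negPf accI).
apply/implyP => /and3P[kI iI le_I]; apply: contraT => accI.
have [|m mJ mI] := inHommel I _ accI; first by rewrite k_gt0.
have /(_ k) := local_rejectsPn crit p I k_gt0 accI.
rewrite leqnn kI => /(_ isT).
rewrite ltnNge -ordered_pvalue_le ?k_gt0 // -ltNge.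
apply: contraLR => _; rewrite -leNgt (le_trans le_I) // (le_trans le_pi) //.
apply: crit_decr => //; rewrite -?mI; first exact: leq_bigmax_cond.
by rewrite maxJ -ltnS.
Qed.

(** The closure principle, adapted to the k - 1 automatic rejections: k
    rejected members of T cannot all be automatic, and the one of largest rank
    has at least k members of T at or below it, so T is among the sets whose
    rejection it required. *)
Lemma closed_testing_local_rejects (R : realType) (n k : nat)
    (crit : nat -> nat -> R) (p : 'I_n -> R) (s : {perm 'I_n})
    (T : {set 'I_n}) :
  (0 < k)%N -> is_ordering p s ->
  (k <= #|T :&: closed_testing k crit p s|)%N -> local_rejects k crit p T.
Proof.
move=> k_gt0 ps; set A := _ :&: _ => kA.
have [i0 i0A] : exists i, i \in A.
  by apply/card_gt0P; exact: leq_trans kA.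
(* Ties are broken by rank, so maximize the rank and not the p-value. *)
have [i iA imax] := @arg_maxnP _ i0 (mem A) (rank s) i0A.
have /andP[_ in_] := rank_bounds s i.
have ki : (k <= rank s i)%N.
  rewrite (leq_trans kA) // -[leqRHS]subn0 -(card_ranks_between s 0 in_).
  apply: subset_leq_card; apply/fintype.subsetP => a /imax.
  by rewrite inE.
have : i \in A by [].
rewrite /A finset.in_setI => /andP[iT]; rewrite inE ltnNge ki /=.
have kT : (k <= #|T|)%N.
  by rewrite (leq_trans kA) // subset_leq_card ?finset.subsetIl.
move/forallP/(_ T)/implyP; apply; rewrite kT iT /=.
rewrite ordered_pvalue_le ?k_gt0 ?kT // (leq_trans kA) //.
apply: subset_leq_card; apply/fintype.subsetP => a aA.
rewrite inE (ordering_rank ps); last exact: imax.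
by move: aA; rewrite /A finset.in_setI => /andP[->].
Qed.

(** * Measurability of the rejection events *)

Lemma measurable_fun_true (d : measure_display) (X : measurableType d)
    (h : X -> bool) :
  measurable_fun [set: X]%classic h <-> measurable [set x | h x]%classic.
Proof.
split=> [mh|mh _]; last first.
  by apply: (measurable_fun_bool true); rewrite // classical_sets.setTI.
have := mh measurableT [set true]%classic.
by rewrite classical_sets.setTI; apply.
Qed.

(** A random finite set whose membership events are measurable takes finitely
    many values, each on a measurable event; so any property of it is
    measurable. Cardinality bounds and finite quantifiers are instances. *)
Lemma measurable_fun_finset_pred (d : measure_display) (X : measurableType d)
    (T : finType) (B : X -> {set T}) (h : pred {set T}) :
  (forall t, measurable_fun [set: X]%classic (fun x => t \in B x)) ->
  measurable_fun [set: X]%classic (fun x => h (B x)).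
Proof.
move=> mB; apply/measurable_fun_true.
have -> : [set x | h (B x)]%classic =
    (\bigcup_(A in [set A | h A]) \bigcap_(t in setT)
       [set x | (t \in B x) == (t \in A)])%classic.
  apply/seteqP; split=> x /= => [hB|[A hA AB]].
    by exists (B x) => // t /=.
  by have -> : B x = A by apply/setP => t; exact/eqP/AB.
apply: fin_bigcup_measurable => [|A _]; first exact: finite_finset.
apply: fin_bigcap_measurable => [|t _]; first exact: finite_finset.
apply/measurable_fun_true; case: (t \in A).
  by under eq_fun do rewrite eqb_id; exact: mB.
by under eq_fun do rewrite eqbF_neg; exact: measurable_neg.
Qed.

Lemma measurable_fun_forall (d : measure_display) (X : measurableType d)
    (T : finType) (f : T -> X -> bool) :
  (forall t, measurable_fun [set: X]%classic (f t)) ->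
  measurable_fun [set: X]%classic (fun x => [forall t, f t x]).
Proof.
move=> mf.
rewrite (_ : (fun x => _) =
             (fun x => [set t | f t x] == [set: T])); last first.
  apply/funext => x; apply/forallP/eqP => [ft|ft t].
    by apply/setP => t; rewrite !inE ft.
  by have := finset.in_setT t; rewrite -ft inE.
apply: (@measurable_fun_finset_pred _ _ _ (fun x => [set t | f t x])
  (fun A => A == [set: T])) => t.
by under eq_fun do rewrite inE; exact: mf.
Qed.

Lemma measurable_fun_exists (d : measure_display) (X : measurableType d)
    (T : finType) (f : T -> X -> bool) :
  (forall t, measurable_fun [set: X]%classic (f t)) ->
  measurable_fun [set: X]%classic (fun x => [exists t, f t x]).
Proof.
move=> mf; under eq_fun do rewrite -[[exists t, _]]negbK negb_exists.
by apply/measurable_neg/measurable_fun_forall => t; exact: measurable_neg.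
Qed.

(** The guard b usually carries the range hypotheses under which h is known to
    be measurable. *)
Lemma measurable_fun_andb_const (d : measure_display) (X : measurableType d)
    (b : bool) (h : X -> bool) :
  (b -> measurable_fun [set: X]%classic h) ->
  measurable_fun [set: X]%classic (fun x => b && h x).
Proof. by case: b => [|_]; [apply | exact: measurable_cst]. Qed.

Section MeasurableRejections.
Context {R : realType} {d : measure_display} {X : measurableType d} {n : nat}.
Implicit Types (P : 'I_n -> {mfun X >-> R}) (I : {set 'I_n}) (k : nat)
  (crit : nat -> nat -> R) (ord : X -> {perm 'I_n}).

(** The threshold is random because closed testing compares P_{k:I} with a
    p-value; local tests use a constant one. *)
Lemma measurable_ordered_pvalue_le P I (j : nat) (f : {mfun X >-> R}) :
  (0 < j <= #|I|)%N ->
  measurable_fun [set: X]%classic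
    (fun x => ordered_pvalue (pvalues P x) I j <= f x).
Proof.
move=> jI; under eq_fun do rewrite ordered_pvalue_le //.
apply: (@measurable_fun_finset_pred _ _ _
  (fun x => [set i in I | P i x <= f x]) (fun A => (j <= #|A|)%N)) => i.
under eq_fun do rewrite inE.
apply: measurable_fun_andb_const => _.
by apply: measurable_fun_ler; exact: measurable_funPT.
Qed.

Lemma measurable_local_rejects P k crit I : (0 < k)%N ->
  measurable_fun [set: X]%classic
    (fun x => local_rejects k crit (pvalues P x) I).
Proof.
move=> k_gt0; apply: measurable_fun_exists => j.
apply: measurable_fun_andb_const => /andP[kj jI].
apply: (@measurable_ordered_pvalue_le _ _ _ (cst (crit j #|I|))).
by rewrite jI (leq_trans k_gt0).
Qed.

Lemma measurable_rank P ord i r : measurable_ordering P ord ->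
  measurable_fun [set: X]%classic (fun x => (rank (ord x) i < r)%N).
Proof.
move=> [_ mord]; apply/measurable_fun_true.
have -> : [set x | (rank (ord x) i < r)%N]%classic =
  (\bigcup_(s in [set s | (rank s i < r)%N]) [set x | ord x = s])%classic.
  by apply/seteqP; split=> x /= => [lt_r|[s lt_r ->]//]; exists (ord x).
by apply: fin_bigcup_measurable => [|s _]; first exact: finite_finset.
Qed.

Lemma measurable_closed_testing P k crit ord i :
  (0 < k)%N -> measurable_ordering P ord ->
  measurable_fun [set: X]%classic
    (fun x => i \in closed_testing k crit (pvalues P x) (ord x)).
Proof.
move=> k_gt0 mord; under eq_fun do rewrite inE.
apply: measurable_or; first exact: measurable_rank mord.
apply: measurable_fun_forall => I.
under eq_fun do rewrite -[_ ==> _]negbK negb_imply andbA -andbA.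
apply: measurable_neg; apply: measurable_fun_andb_const => /andP[kI _].
apply: measurable_and.
  by apply: measurable_ordered_pvalue_le; rewrite k_gt0.
by apply: measurable_neg; exact: measurable_local_rejects.
Qed.

Lemma measurable_false_rejections (H : 'I_n -> set (probability X R)) P k crit
    ord Q : (0 < k)%N -> measurable_ordering P ord ->
  measurable_fun [set: X]%classic (fun x =>
    (k <= false_rejections H P ord (closed_testing k crit) Q x)%N).
Proof.
move=> k_gt0 mord; rewrite /false_rejections.
apply: (@measurable_fun_finset_pred _ _ _ (fun x => true_nulls H Q :&:
  closed_testing k crit (pvalues P x) (ord x)) (fun A => (k <= #|A|)%N)) => i.
under eq_fun do rewrite finset.in_setI.
by apply: measurable_fun_andb_const => _; exact: measurable_closed_testing.
Qed.

End MeasurableRejections.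

(** * Control of the k-FWER *)

Lemma equivalent_kFWER (R : realType) (d : measure_display)
    (X : measurableType d) (n k : nat) (H : 'I_n -> set (probability X R))
    (P : 'I_n -> {mfun X >-> R}) (ord : X -> {perm 'I_n})
    (phi psi : procedure R n) (Q : probability X R) :
  measurable_ordering P ord -> equivalent phi psi ->
  kFWER H P ord phi k Q = kFWER H P ord psi k Q.
Proof.
move=> [ordP _] phipsi; rewrite /kFWER /false_rejections; congr (Q _).
by apply/seteqP; split=> x /=; rewrite phipsi.
Qed.

Lemma closed_testing_controls_kFWER (R : realType) (d : measure_display)
    (X : measurableType d) (n k : nat) (Omega : set (probability X R))
    (H : 'I_n -> set (probability X R)) (P : 'I_n -> {mfun X >-> R})
    (ord : X -> {perm 'I_n}) (crit : nat -> nat -> R) (alpha : R) :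
  (0 < k)%N -> measurable_ordering P ord -> 0 <= alpha ->
  (forall I : {set 'I_n}, (k <= #|I|)%N ->
    level_local_test H P k crit I alpha) ->
  controls_kFWER Omega H P ord (closed_testing k crit) k alpha.
Proof.
move=> k_gt0 mord alpha_ge0 level Q _; rewrite /kFWER.
pose T := true_nulls H Q.
(* With fewer than k true nulls there is nothing to bound but alpha >= 0. *)
have [kT|lt_Tk] := leqP k #|T|.
  have HT : intersection_hypothesis H T Q.
    by move=> i /=; rewrite inE => /asboolP.
  apply: le_trans (level T kT Q HT).
  apply: le_measure; rewrite ?inE.
  - exact/measurable_fun_true/measurable_false_rejections.
  - exact/measurable_fun_true/measurable_local_rejects.
  move=> x /=; apply: closed_testing_local_rejects => //.
  by case: mord => ordP _; exact: ordP.
rewrite (_ : [set x | _]%classic = classical_sets.set0) ?measure0 ?lee_fin //.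
apply/seteqP; split=> x //=; rewrite leqNgt => /negP; apply.
by rewrite (leq_ltn_trans _ lt_Tk) // subset_leq_card // finset.subsetIl.
Qed.

Theorem theorem5p1 (R : realType) (d : measure_display) (X : measurableType d)
    (n k : nat) (Omega : set (probability X R))
    (H : 'I_n -> set (probability X R)) (P : 'I_n -> {mfun X >-> R})
    (ord : X -> {perm 'I_n}) (crit : nat -> nat -> R)
    (k_range : (1 <= k <= n)%N)
    (H_sub : forall i, (H i `<=` Omega)%classic)
    (H_free : free_combination Omega H)
    (P_valid : valid_pvalues H P)
    (ord_ok : measurable_ordering P ord)
    (crit_incr : forall i i' m : nat, (k <= i)%N -> (i <= i')%N ->
      (i' <= m)%N -> (m <= n)%N -> crit i m <= crit i' m)
    (crit_decr : forall i m m' : nat, (k <= i)%N -> (i <= m)%N ->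
      (m <= m')%N -> (m' <= n)%N -> crit i m' <= crit i m) :
  equivalent (closed_testing k crit : procedure R n) (hommel k crit) /\
  (forall alpha : R,
    (forall I : {set 'I_n}, (k <= #|I|)%N ->
      level_local_test H P k crit I alpha) ->
    controls_kFWER Omega H P ord (hommel k crit) k alpha).
Proof.
have /andP[k_gt0 kn] := k_range.
have equiv : equivalent (closed_testing k crit : procedure R n) (hommel k crit).
  by apply: closed_testing_eq_hommel => // m m' km; exact: crit_decr.
split=> // alpha level Q OmegaQ.
rewrite -(equivalent_kFWER k H Q ord_ok equiv).
apply: (closed_testing_controls_kFWER k_gt0 ord_ok _ level OmegaQ).
(* A distribution satisfying every hypothesis shows that alpha bounds a
   probability. *)
have [Q0 _ HQ0] := H_free [set: 'I_n].
have Q0all : intersection_hypothesis H [set: 'I_n] Q0.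
  by move=> i _; apply/HQ0; rewrite inE.
rewrite -lee_fin (le_trans _ (level _ _ _ Q0all)) ?measure_ge0 //.
by rewrite cardsT card_ord.
Qed.
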